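(* Let $k$ be a field, $S=k[x_1,\ldots,x_n]$, and let $\Delta$ be a simplicial forest with vertices in $\{x_1,\ldots,x_n\}$, with more than one facet, and with facet ideal $I\subseteq S$. Suppose $\beta_{i,n}(\Delta)\neq 0$, and $i=a+b$ for some positive integers $a$ and $b$. Then there are subsets $u,w\subseteq\{x_1,\ldots,x_n\}$ such that the induced subcollections $\Delta_{[u]}$ and $\Delta_{[w]}$ are complements in $\Delta$, with $\beta_{a,|u|}(\Delta_{[u]})\neq 0$ and $\beta_{b,|w|}(\Delta_{[w]})\neq 0$.
   Context: A simplicial complex $\Delta$ is a set of subsets (faces) of a finite set closed under taking subsets; its facets are the inclusion-maximal faces, and its vertex set $V(\Delta)$ is the union of its facets. A subcollection of $\Delta$ is a simplicial complex whose facets are facets of $\Delta$. A facet $F$ of $\Delta$ is a leaf if either $F$ is the only facet of $\Delta$, or there is a facet $G\neq F$ of $\Delta$ such that $F\cap H\subseteq G$ for every facet $H\neq F$ of $\Delta$. $\Delta$ is a simplicial forest if every nonempty subcollection of $\Delta$ has a leaf. For a set $u$ of vertices, the induced subcollection $\Delta_{[u]}$ is the subcollection of $\Delta$ whose facets are all the facets of $\Delta$ contained in $u$. Facet ideal: for $u\subseteq\{x_1,\ldots,x_n\}$ let $\mathbf{m}_u=\prod_{x_i\in u}x_i$. The facet ideal of $\Delta$ is the ideal $(\mathbf{m}_F : F \text{ a facet of }\Delta)$ of $S$ (the zero ideal if there are no facets). For a simplicial complex $\Delta$ with facet ideal $I\subseteq S$, $\beta_{i,j}(\Delta)$ means $\beta_{i,j}(S/I)$,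 the graded Betti number of $S/I$, i.e. the rank of the summand $S(-j)$ in homological degree $i$ of the minimal graded free resolution of $S/I$ over $S$ (with $S$ in homological degree $0$). Complements: for a simplicial complex $\Delta$ with vertex set $\{x_1,\ldots,x_n\}$ and proper subsets $u,v$ of $\{x_1,\ldots,x_n\}$, the induced subcollections $\Delta_{[u]}$ and $\Delta_{[v]}$ are called complements in $\Delta$ if (a) $u\cup v=\{x_1,\ldots,x_n\}$, and (b) $\Delta_{[u]}$ and $\Delta_{[v]}$ have no facet in common. (In the claim, $\beta_{i,n}(\Delta)\neq 0$ forces the vertex set of $\Delta$ to be all of $\{x_1,\ldots,x_n\}$.) *)

(* Defs.v *)
From Stdlib Require Import ClassicalEpsilon.
From HB Require Import structures.
From mathcomp Require Import all_boot all_order all_algebra.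
From mathcomp Require Import mpoly.

Set Implicit Arguments.
Unset Strict Implicit.
Unset Printing Implicit Defensive.

Import GRing.Theory.

Local Open Scope ring_scope.

(** Simplicial complexes on a finite type, given by their sets of faces.
    The void complex [set0] (no faces, no facets) is allowed and is distinct
    from [[set set0]], whose only facet is the empty set. *)

Definition simplicial_complex (T : finType) (D : {set {set T}}) : Prop :=
  forall F G : {set T}, F \in D -> G \subset F -> G \in D.

Definition facets (T : finType) (D : {set {set T}}) : {set {set T}} :=
  [set F in D | [forall G in D, (F \subset G) ==> (G == F)]].

Definition vertices (T : finType) (D : {set {set T}}) : {set T} :=
  \bigcup_(F in facets D) F.

Definition subcollection (T : finType) (D' D : {set {set T}}) : Prop :=
  simplicial_complex D' /\ facets D' \subset facets D.

Definition leaf (T : finType) (D : {set {set T}}) (F : {set T}) : Prop :=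
  F \in facets D /\
  (facets D = [set F] \/
   exists G : {set T}, [/\ G \in facets D, G != F
     & forall H : {set T}, H \in facets D -> H != F -> F :&: H \subset G]).

Definition simplicial_forest (T : finType) (D : {set {set T}}) : Prop :=
  simplicial_complex D /\
  (forall D' : {set {set T}}, subcollection D' D -> D' != set0 ->
     exists F : {set T}, leaf D' F).

Definition induced (T : finType) (D : {set {set T}}) (u : {set T}) :
    {set {set T}} :=
  [set f : {set T} |
    [exists F : {set T}, [&& F \in facets D, F \subset u & f \subset F]]].

(** Complementary induced subcollections are only considered when the vertex
    set of [D] is the whole of [T], hence the first conjunct. *)
Definition complements (T : finType) (D : {set {set T}}) (u v : {set T}) :
    Prop :=
  [/\ vertices D = [set: T],
      u \proper [set: T], v \proper [set: T],
      u :|: v = [set: T]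
    & [disjoint facets (induced D u) & facets (induced D v)]].

(** Ideals are represented by their membership predicates. *)

Definition facet_ideal (k : fieldType) (n : nat) (D : {set {set 'I_n}})
    (f : {mpoly k[n]}) : Prop :=
  exists c : {set 'I_n} -> {mpoly k[n]},
    f = \sum_(F in facets D) c F * \prod_(x in F) 'X_x.

(** A minimal graded free resolution of [S/I], [S := {mpoly k[n]}]:
    [... -> F_2 -> F_1 -> F_0 -> S/I -> 0], where [F_i] is the direct sum of
    the [S(-mgr_deg i p)] for [p : 'I_(mgr_rank i)].  Elements of [F_i] are row
    vectors, and [F_(i+1) -> F_i] is right multiplication by [mgr_diff i].
    The augmentation [F_0 -> S/I] is given by the column [mgr_aug] of
    homogeneous representatives of the images of the basis of [F_0].
    Since [S/I] vanishes in negative degrees, a minimal resolution only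
    involves shifts with [mgr_deg i p >= 0], so natural numbers suffice.
    The homogeneity fields express that all maps have degree 0, and
    [mgr_minimal] that the image of [F_(i+1)] lies in [(x_1, ..., x_n) F_i]. *)
Record minimal_graded_resolution (k : fieldType) (n : nat)
    (I : {mpoly k[n]} -> Prop) : Type := MinimalGradedResolution {
  mgr_rank : nat -> nat;
  mgr_deg : forall i : nat, 'I_(mgr_rank i) -> nat;
  mgr_aug : 'cV[{mpoly k[n]}]_(mgr_rank 0%N);
  mgr_diff : forall i : nat, 'M[{mpoly k[n]}]_(mgr_rank i.+1, mgr_rank i);
  mgr_aug_homog : forall (q : 'I_(mgr_rank 0%N)) (m : 'X_{1..n}),
    m \in msupp (mgr_aug q 0) -> mdeg m = mgr_deg q;
  mgr_diff_homog : forall (i : nat) (p : 'I_(mgr_rank i.+1))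
      (q : 'I_(mgr_rank i)) (m : 'X_{1..n}),
    m \in msupp (mgr_diff i p q) -> (mdeg m + mgr_deg q)%N = mgr_deg p;
  mgr_aug_surj : forall f : {mpoly k[n]},
    exists v : 'rV[{mpoly k[n]}]_(mgr_rank 0%N), I (f - (v *m mgr_aug) 0 0);
  mgr_exact0 : forall v : 'rV[{mpoly k[n]}]_(mgr_rank 0%N),
    I ((v *m mgr_aug) 0 0) <->
    exists w : 'rV[{mpoly k[n]}]_(mgr_rank 1%N), v = w *m mgr_diff 0%N;
  mgr_exact : forall (i : nat) (v : 'rV[{mpoly k[n]}]_(mgr_rank i.+1)),
    v *m mgr_diff i = 0 <->
    exists w : 'rV[{mpoly k[n]}]_(mgr_rank i.+2), v = w *m mgr_diff i.+1;
  mgr_minimal : forall (i : nat) (p : 'I_(mgr_rank i.+1))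
      (q : 'I_(mgr_rank i)),
    (mgr_diff i p q)@_0%MM = 0
}.

(** The number of summands [S(-j)] in homological degree [i].  A minimal graded
    free resolution of [S/I] exists for every homogeneous ideal [I] and is
    unique up to isomorphism, so the choice made by [epsilon] is immaterial. *)
Definition graded_betti (k : fieldType) (n : nat) (I : {mpoly k[n]} -> Prop)
    (i j : nat) : nat :=
  epsilon (inhabits 0%N) (fun b : nat =>
    exists R : minimal_graded_resolution I,
      b = #|[set p : 'I_(mgr_rank R i) | mgr_deg p == j]|).

Definition betti (k : fieldType) (n : nat) (D : {set {set 'I_n}})
    (i j : nat) : nat :=
  graded_betti (@facet_ideal k n D) i j.

Arguments betti k {n} D i j.

(* Main.v *)
(** Let F be a facet with a vertex y lying in no other facet (every leaf of a
    forest is one), E the family of the other facets and E_F = {G \ F | G in E},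
    which generates (E : m_F).  Then the mapping cone of multiplication by m_F,
    from S/(E_F) to S/(E), is a minimal resolution: the comparison map can be
    chosen divisible by y.  In the top degree V only the E_F summand
    contributes, so beta_{i,V} of E with F added is nonzero iff
    beta_{i-1,V\F}(E_F) is.

    Next, Betti numbers survive delocalization: if beta_{i,V\A}(E_A) is nonzero,
    then so is beta_{i,w}(E[w]) for some w in V with w \ A = V \ A.  This follows
    by inverting one variable x at a time and removing a facet with a free
    vertex different from x; it exists because a forest has two leaves.

    For i = a + b split the degree i - 1 part of E_F by induction into degrees
    a - 1 and b with complementary supports u' and w' (u' is empty if a = 1).
    Then u = F + u' works in homological degree a, and delocalizing w' gives a
    w in homological degree b that avoids y. *)

From Stdlib Require Import ClassicalEpsilon FunctionalExtensionality PropExtensionality.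
Require Import Defs.
From mathcomp Require Import all_boot all_order all_algebra.
From mathcomp Require Import mpoly ring.

Set Implicit Arguments.
Unset Strict Implicit.
Unset Printing Implicit Defensive.

Import GRing.Theory.

(** * Homogeneous matrices and ideals *)

Section Homogeneity.

Local Open Scope ring_scope.
Variables (k : fieldType) (n : nat).
Implicit Types (f g : {mpoly k[n]}) (s t : nat).

Definition mfilter (P : pred 'X_{1..n}) f : {mpoly k[n]} :=
  \sum_(m <- msupp f | P m) f@_m *: 'X_[m].

Lemma mcoeff_mfilter P f m : (mfilter P f)@_m = if P m then f@_m else 0.
Proof.
rewrite /mfilter raddf_sum /=.
have [m_f | m_f] := boolP (m \in msupp f); last first.
  rewrite (memN_msupp_eq0 m_f) if_same big_seq_cond big1 // => m' /andP[m'_f _].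
  rewrite mcoeffZ mcoeffX; case: eqP => [e|]; last by rewrite mulr0.
  by rewrite -e m'_f in m_f.
rewrite big_mkcond (bigD1_seq m) ?msupp_uniq //= big1 ?addr0 => [|m' /negPf ne].
  by case: ifP => // _; rewrite mcoeffZ mcoeffX eqxx mulr1.
by case: ifP => // _; rewrite mcoeffZ mcoeffX ne mulr0.
Qed.

(* The component of degree [t - s], and [0] if [t < s]. *)
Definition hpart s t f : {mpoly k[n]} := mfilter (fun m => mdeg m + s == t)%N f.

Lemma mcoeff_hpart s t f m :
  (hpart s t f)@_m = if (mdeg m + s == t)%N then f@_m else 0.
Proof. exact: mcoeff_mfilter. Qed.

Lemma msupp_hpart s t f m :
  (m \in msupp (hpart s t f)) = (m \in msupp f) && (mdeg m + s == t)%N.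
Proof.
by rewrite !mcoeff_msupp mcoeff_hpart; case: ifP => _; rewrite ?eqxx ?andbT ?andbF.
Qed.

Lemma hpart_id s t f :
  (forall m, m \in msupp f -> (mdeg m + s)%N = t) -> hpart s t f = f.
Proof.
move=> hf; apply/mpolyP => m; rewrite mcoeff_hpart.
case: ifP => // /negP ne; case: (boolP (m \in msupp f)) => [/hf/eqP //|].
by move/memN_msupp_eq0.
Qed.

Lemma hpart_sum s t (J : finType) (F : J -> {mpoly k[n]}) :
  hpart s t (\sum_j F j) = \sum_j hpart s t (F j).
Proof.
apply/mpolyP => m; rewrite mcoeff_hpart !raddf_sum /=.
under [RHS]eq_bigr => j _ do rewrite mcoeff_hpart.
by case: ifP => // _; rewrite big1.
Qed.

(** A homogeneous factor only shifts degrees, so it passes through the extraction of graded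
    pieces. *)
Lemma hpartM r s t f g :
  (forall m, m \in msupp g -> (mdeg m + r)%N = s) ->
  hpart r t (f * g) = hpart s t f * g.
Proof.
move=> hg; apply/mpolyP => m; rewrite mcoeff_hpart !mcoeffM.
transitivity (\sum_(l : 'X_{1..n < (mdeg m).+1, (mdeg m).+1} | m == (l.1 + l.2)%MM)
   (if (mdeg m + r == t)%N then f@_l.1 * g@_l.2 else 0)).
  by case: ifP => // _; rewrite big1.
apply: eq_bigr => l /eqP em; rewrite mcoeff_hpart.
have ->: (mdeg m + r == t)%N = (mdeg l.1 + mdeg l.2 + r == t)%N.
  by rewrite -mdegD -em.
case: (boolP ((l.2 : 'X_{1..n}) \in msupp g)) => [/hg <-|/memN_msupp_eq0->].
  by rewrite addnA; case: ifP => // _; rewrite mul0r.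
by rewrite !mulr0 if_same.
Qed.

(** A degree-0 map from the sum of the S(-[dp p]) to the sum of the S(-[dq q]), acting on row
    vectors from the right. *)
Definition homog_mx a b (dp : 'I_a -> nat) (dq : 'I_b -> nat)
    (M : 'M[{mpoly k[n]}]_(a, b)) : Prop :=
  forall p q m, m \in msupp (M p q) -> (mdeg m + dq q)%N = dp p.

Definition hpart_mx a b (dp : 'I_a -> nat) (dq : 'I_b -> nat)
    (M : 'M[{mpoly k[n]}]_(a, b)) : 'M[{mpoly k[n]}]_(a, b) :=
  \matrix_(p, q) hpart (dq q) (dp p) (M p q).

Lemma hpart_mx_homog a b dp dq (M : 'M_(a, b)) :
  homog_mx dp dq (hpart_mx dp dq M).
Proof. by move=> p q m; rewrite mxE msupp_hpart => /andP[_ /eqP]. Qed.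

Lemma hpart_mx_id a b dp dq (M : 'M_(a, b)) :
  homog_mx dp dq M -> hpart_mx dp dq M = M.
Proof. by move=> hM; apply/matrixP => p q; rewrite mxE hpart_id // => m /hM. Qed.

Lemma hpart_mxM a b c dp dq dr (M : 'M_(a, b)) (N : 'M_(b, c)) :
  homog_mx dq dr N -> hpart_mx dp dr (M *m N) = hpart_mx dp dq M *m N.
Proof.
move=> hN; apply/matrixP => p r; rewrite !mxE hpart_sum; apply: eq_bigr => q _.
by rewrite !mxE; apply: hpartM => m /hN.
Qed.

Lemma homog_mxM a b c dp dq dr (M : 'M_(a, b)) (N : 'M_(b, c)) :
  homog_mx dp dq M -> homog_mx dq dr N -> homog_mx dp dr (M *m N).
Proof.
move=> hM hN; rewrite -(hpart_mx_id hM) -(hpart_mxM _ _ hN).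
exact: hpart_mx_homog.
Qed.

(** Taking graded parts of both sides makes any factorization through a homogeneous [N]
    homogeneous. *)
Lemma homog_mx_factor a b c dp dq dr (M : 'M_(a, c)) (W : 'M_(a, b))
    (N : 'M_(b, c)) :
  homog_mx dp dr M -> homog_mx dq dr N -> M = W *m N ->
  M = hpart_mx dp dq W *m N.
Proof. by move=> hM hN e; rewrite -(hpart_mxM _ _ hN) -e hpart_mx_id. Qed.

Lemma homog_mx_add_deg a b (dp : 'I_a -> nat) (dq : 'I_b -> nat) e M :
  homog_mx dp dq M ->
  homog_mx (fun p => (dp p + e)%N) (fun q => (dq q + e)%N) M.
Proof. by move=> hM p q m /hM <-; rewrite addnA. Qed.

Lemma homog_mxZ a b (dp : 'I_a -> nat) (dq : 'I_b -> nat) e g M :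
  (forall m, m \in msupp g -> mdeg m = e) -> homog_mx dp dq M ->
  homog_mx (fun p => (dp p + e)%N) dq (g *: M).
Proof.
move=> hg hM p q m; rewrite mxE => /msuppM_le /allpairsP[[m1 m2] /= [/hg <- /hM <- ->]].
by rewrite mdegD -addnA addnC.
Qed.

Definition homogeneous_ideal (I : {mpoly k[n]} -> Prop) : Prop :=
  [/\ I 0, forall f g, I f -> I g -> I (f + g),
      forall f g, I g -> I (f * g) & forall s t f, I f -> I (hpart s t f)].

Lemma ideal_add I f g : homogeneous_ideal I -> I f -> I g -> I (f + g).
Proof. by case=> _ hD _ _; apply: hD. Qed.

Lemma ideal_mul I f g : homogeneous_ideal I -> I g -> I (f * g).
Proof. by case=> _ _ hM _; apply: hM. Qed.

Lemma ideal_opp I f : homogeneous_ideal I -> I f -> I (- f).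
Proof. by move=> hI If; rewrite -mulN1r; apply: ideal_mul. Qed.

Lemma ideal_sum I (J : finType) (F : J -> {mpoly k[n]}) :
  homogeneous_ideal I -> (forall j, I (F j)) -> I (\sum_j F j).
Proof.
by case=> I0 hD _ _ IF; elim/big_rec: _ => [|j f _ If]; [|apply: hD].
Qed.

Lemma ideal_mulmx I a b c (W : 'M_(a, b)) (N : 'M_(b, c)) :
  homogeneous_ideal I -> (forall p q, I (N p q)) ->
  forall p q, I ((W *m N) p q).
Proof.
move=> hI IN p q; rewrite mxE; apply: ideal_sum => // j.
exact: ideal_mul.
Qed.

End Homogeneity.

(** * Chain maps between minimal resolutions *)

Section Resolutions.

Local Open Scope ring_scope.
Variables (k : fieldType) (n : nat).
Implicit Types (f g : {mpoly k[n]}) (I K : {mpoly k[n]} -> Prop).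

Notation resolution := (@minimal_graded_resolution k n).

Lemma mx_row_choice a b c (M : 'M[{mpoly k[n]}]_(a, c)) (N : 'M_(b, c)) :
  (forall p, exists w : 'rV_b, row p M = w *m N) -> exists W, M = W *m N.
Proof.
case/fin_all_exists => W hW; exists (\matrix_p W p).
by apply/row_matrixP => p; rewrite hW row_mul rowK.
Qed.

Lemma mgr_diff_comp I (R : resolution I) i :
  mgr_diff R i.+1 *m mgr_diff R i = 0.
Proof.
apply/row_matrixP => p; rewrite row_mul row0.
by apply/mgr_exact; exists (delta_mx 0 p); rewrite rowE.
Qed.

Lemma mgr_diff_aug I (R : resolution I) p : I ((mgr_diff R 0 *m mgr_aug R) p 0).
Proof.
have -> : (mgr_diff R 0 *m mgr_aug R) p 0 =
  (row p (mgr_diff R 0) *m mgr_aug R) 0 0 by rewrite -row_mul [RHS]mxE.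
by apply/mgr_exact0; exists (delta_mx 0 p); rewrite rowE.
Qed.

Lemma homog_aug I (R : resolution I) :
  homog_mx (@mgr_deg _ _ _ R 0) (fun=> 0%N) (mgr_aug R).
Proof. by move=> p q m; rewrite ord1 addn0 => /mgr_aug_homog. Qed.

Lemma homog_diff I (R : resolution I) i :
  homog_mx (@mgr_deg _ _ _ R i.+1) (@mgr_deg _ _ _ R i) (mgr_diff R i).
Proof. by move=> p q m /mgr_diff_homog. Qed.

Lemma lift_aug I (R : resolution I) a (dp : 'I_a -> nat) (c : 'cV_a) :
  homogeneous_ideal I -> homog_mx dp (fun=> 0%N) c ->
  exists2 phi : 'M_(a, mgr_rank R 0),
    homog_mx dp (@mgr_deg _ _ _ R 0) phi &
    forall p q, I ((c - phi *m mgr_aug R) p q).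
Proof.
move=> hI hc.
have [W hW] : exists W : 'M_(a, mgr_rank R 0),
    forall p q, I ((c - W *m mgr_aug R) p q).
  have [w hw] := fin_all_exists (fun p => mgr_aug_surj R (c p 0)).
  exists (\matrix_p w p) => p q; rewrite ord1 2!mxE.
  suff -> : (\matrix_p0 w p0 *m mgr_aug R) p 0 = (w p *m mgr_aug R) 0 0 by [].
  by rewrite !mxE; apply: eq_bigr => j _; rewrite mxE.
exists (hpart_mx dp (@mgr_deg _ _ _ R 0) W); first exact: hpart_mx_homog.
move=> p q; rewrite -(hpart_mxM _ _ (@homog_aug _ R)) -[c](hpart_mx_id hc).
have -> : (hpart_mx dp (fun=> 0%N) c - hpart_mx dp (fun=> 0%N) (W *m mgr_aug R)) p q
   = hpart 0 (dp p) ((c - W *m mgr_aug R) p q).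
  rewrite !mxE; apply/mpolyP => m; rewrite mcoeffB !mcoeff_hpart.
  by case: ifP; rewrite ?subr0 // mcoeffB.
by case: hI => _ _ _; apply.
Qed.

Lemma lift_diff0 I (R : resolution I) a (c : 'M_(a, mgr_rank R 0)) :
  (forall p q, I ((c *m mgr_aug R) p q)) -> exists W, c = W *m mgr_diff R 0.
Proof.
move=> hc; apply: mx_row_choice => p; apply/mgr_exact0.
by rewrite -row_mul mxE; apply: hc.
Qed.

Lemma lift_diff I (R : resolution I) i a (c : 'M_(a, mgr_rank R i.+1)) :
  c *m mgr_diff R i = 0 -> exists W, c = W *m mgr_diff R i.+1.
Proof.
move=> hc; apply: mx_row_choice => p; apply/mgr_exact.
by rewrite -row_mul hc row0.
Qed.

(** Multiplication by [g] from S/K to S/I lifts to the resolutions one homological degree at a time;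
    each lift is replaced by its graded part. *)
Lemma chain_map I K (R : resolution I) (Q : resolution K) g e :
  homogeneous_ideal I -> (forall f, K f -> I (g * f)) ->
  (forall m, m \in msupp g -> mdeg m = e) ->
  exists phi : forall i, 'M_(mgr_rank Q i, mgr_rank R i),
    [/\ forall i, homog_mx (fun p => (@mgr_deg _ _ _ Q i p + e)%N)
                    (@mgr_deg _ _ _ R i) (phi i),
        forall p q, I ((g *: mgr_aug Q - phi 0%N *m mgr_aug R) p q) &
        forall i, mgr_diff Q i *m phi i = phi i.+1 *m mgr_diff R i].
Proof.
move=> hI hgI hg.
pose dQ i p := (@mgr_deg _ _ _ Q i p + e)%N; pose dR := @mgr_deg _ _ _ R.
pose good i (phi : 'M[{mpoly k[n]}]_(mgr_rank Q i, mgr_rank R i)) :=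
  homog_mx (dQ i) (dR i) phi.
(* The recursion carries each map together with the existence of a next one, so that the following
   choice can be made. *)
pose ok i phi := good i phi /\
  exists2 psi, good i.+1 psi & mgr_diff Q i *m phi = psi *m mgr_diff R i.
have lift i phi : good i phi -> (exists psi, mgr_diff Q i *m phi = psi *m mgr_diff R i) ->
    ok i phi.
  move=> hphi [psi hpsi]; split => //.
  exists (hpart_mx (dQ i.+1) (dR i.+1) psi); first exact: hpart_mx_homog.
  apply: homog_mx_factor hpsi; last exact: homog_diff.
  apply: (homog_mxM _ hphi).
  exact: (homog_mx_add_deg e (@homog_diff _ Q i)).
have [phi0 hphi0 Iphi0] := lift_aug R hI (homog_mxZ hg (homog_aug (R := Q))).
have ok0 : ok 0%N phi0.
  apply: lift => //; apply: lift_diff0 => p q.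
  (* The first term lies in [I] because [g] maps [K] into [I], the second because [phi0] lifts
     multiplication by [g] modulo [I]. *)
  have -> : (mgr_diff Q 0 *m phi0 *m mgr_aug R) =
     g *: (mgr_diff Q 0 *m mgr_aug Q)
     - mgr_diff Q 0 *m (g *: mgr_aug Q - phi0 *m mgr_aug R).
    by rewrite mulmxBr -scalemxAr subKr mulmxA.
  rewrite [X in I X]mxE [X in X + _]mxE [X in _ + X]mxE.
  apply: ideal_add => //.
    by rewrite ord1; apply: hgI; apply: mgr_diff_aug.
  by apply: ideal_opp => //; apply: ideal_mulmx.
have okS i phi : ok i phi -> exists psi : 'M_(mgr_rank Q i.+1, mgr_rank R i.+1),
    mgr_diff Q i *m phi = psi *m mgr_diff R i /\ ok i.+1 psi.
  case=> hphi [psi hpsi e1]; exists psi; split=> //; apply: lift => //.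
  by apply: lift_diff; rewrite -mulmxA -e1 mulmxA mgr_diff_comp mul0mx.
pose next i (s : {phi | ok i phi}) : {psi | ok i.+1 psi} :=
  let c := constructive_indefinite_description _ (okS i (sval s) (svalP s)) in
  exist _ (sval c) (proj2 (svalP c)).
pose Phi := nat_rect (fun i => {phi | ok i phi}) (exist _ phi0 ok0) next.
exists (fun i => sval (Phi i)); split=> [i||i].
- exact: (svalP (Phi i)).1.
- exact: Iphi0.
- exact: (proj1 (svalP (constructive_indefinite_description _
    (okS i (sval (Phi i)) (svalP (Phi i)))))).
Qed.

Local Notation mod_vars := (map_mx (mcoeff 0%MM)).

(* Two lifts of the identity compose to a map homotopic to the identity, hence
   equal to it modulo the variables by minimality. *)
Lemma mgr_deg_unique I (R R' : resolution I) i j :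
  homogeneous_ideal I ->
  (exists p : 'I_(mgr_rank R i), mgr_deg p = j) ->
  exists p : 'I_(mgr_rank R' i), mgr_deg p = j.
Proof.
move=> hI [p hp].
have h1 (m : 'X_{1..n}) : m \in msupp (1 : {mpoly k[n]}) -> mdeg m = 0%N.
  by rewrite msupp1 inE => /eqP ->; rewrite mdeg0.
have hI1 f : I f -> I (1 * f) by rewrite mul1r.
have [phi [hphi aphi cphi]] := chain_map R' R hI hI1 h1.
have [psi [_ apsi cpsi]] := chain_map R R' hI hI1 h1.
pose h l := phi l *m psi l - 1%:M.
have hdiff l : h l.+1 *m mgr_diff R l = mgr_diff R l *m h l.
  rewrite mulmxBl mul1mx mulmxBr mulmx1 -mulmxA -cpsi mulmxA -cphi.
  by rewrite -mulmxA.
have [s0 hs0] : exists s, h 0%N = s *m mgr_diff R 0.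
  apply: lift_diff0 => p0 q.
  have -> : h 0%N *m mgr_aug R = - (1 *: mgr_aug R - phi 0%N *m mgr_aug R') -
       phi 0%N *m (1 *: mgr_aug R' - psi 0%N *m mgr_aug R).
    rewrite !scale1r mulmxBl mul1mx mulmxBr !mulmxA !opprB.
    by rewrite [RHS]addrC addrA subrK.
  rewrite [X in I X]mxE [X in X + _]mxE [X in _ + X]mxE.
  apply: ideal_add => //; first exact: ideal_opp.
  by apply: ideal_opp => //; apply: ideal_mulmx.
have cd l : mod_vars (mgr_diff R l) = 0.
  by apply/matrixP => x y; rewrite !mxE mgr_minimal.
(* The homotopy is built step by step. [N] is the differential followed by the previous homotopy
   map, so by minimality it vanishes modulo the variables. *)
have hS l : exists s N, [/\ h l = N + s *m mgr_diff R l,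
    mgr_diff R l *m N = 0 & mod_vars N = 0].
  elim: l => [|l [s [N [hl dN cN]]]].
    by exists s0, 0; rewrite add0r mulmx0 raddf0.
  have [t ht] : exists t, h l.+1 - mgr_diff R l *m s = t *m mgr_diff R l.+1.
    apply: lift_diff; rewrite mulmxBl hdiff -mulmxA -mulmxBr hl.
    by rewrite addrK.
  exists t, (mgr_diff R l *m s); split; first by rewrite -ht addrC subrK.
    by rewrite mulmxA mgr_diff_comp mul0mx.
  by rewrite map_mxM cd mul0mx.
have [s [N [hi _ cN]]] := hS i.
have : mod_vars (phi i) *m mod_vars (psi i) = 1%:M.
  rewrite -map_mxM -(subrK 1%:M (phi i *m psi i)) -/(h i) hi !raddfD /= map_mxM.
  by rewrite cN cd mulmx0 !add0r map_mx1.
move/matrixP/(_ p p); rewrite !mxE eqxx => e1.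
(* Row [p] of the first map has a nonzero constant entry; constants have degree 0, so the column of
   that entry has the same shift as [p]. *)
have [q] : exists q, mod_vars (phi i) p q != 0.
  apply/existsP; apply: contraT => /existsPn h0; case/eqP: (oner_neq0 k).
  by rewrite -[LHS]e1 big1 // => q _; move/eqP: (negbNE (h0 q)) ->; rewrite mul0r.
rewrite mxE -mcoeff_msupp => /hphi; rewrite mdeg0 add0n addn0 hp => <-.
by exists q.
Qed.

End Resolutions.

(** * Mapping cones *)

Section MappingCone.

Local Open Scope ring_scope.
Variables (k : fieldType) (n : nat).
Implicit Types (f g : {mpoly k[n]}) (I J K : {mpoly k[n]} -> Prop).

Notation resolution := (@minimal_graded_resolution k n).

Definition shift_rank (r : nat -> nat) (i : nat) : nat :=
  if i is i'.+1 then r i' else 0.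

Definition shift_deg (r : nat -> nat) (deg : forall i, 'I_(r i) -> nat) (e i : nat) :
    'I_(shift_rank r i) -> nat :=
  match i with
  | 0 => fun=> 0
  | i'.+1 => fun p => deg i' p + e
  end%N.

(** The sign makes the two contributions of the comparison map cancel when the cone differential is
    squared. *)
Definition shift_diff (r : nat -> nat)
    (d : forall i, 'M[{mpoly k[n]}]_(r i.+1, r i)) (i : nat) :
    'M[{mpoly k[n]}]_(shift_rank r i.+1, shift_rank r i) :=
  match i with
  | 0%N => 0
  | i'.+1 => - d i'
  end.

Lemma mul_row_block0 a b c d (M : 'M[{mpoly k[n]}]_(a, c)) (N : 'M_(b, c))
    (P : 'M_(b, d)) (v : 'rV_(a + b)) :
  v *m block_mx M 0 N P =
  row_mx (lsubmx v *m M + rsubmx v *m N) (rsubmx v *m P).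
Proof. by rewrite -{1}[v]hsubmxK mul_row_block mulmx0 add0r. Qed.

(** * The cone of ['X_x] times a lift of multiplication by [g] *)

Section Cone.

Variables (I J K : {mpoly k[n]} -> Prop) (R : resolution I) (Q : resolution K).
Variables (x : 'I_n) (g : {mpoly k[n]}) (e : nat).
Hypothesis hI : homogeneous_ideal I.
Hypothesis hKg : forall f, K f -> I (g * f).
Hypothesis hgK : forall f, I ('X_x * g * f) -> K f.
Hypothesis hJ : forall f, J f <-> exists s, I (f - s * ('X_x * g)).
Variable phi : forall i, 'M[{mpoly k[n]}]_(mgr_rank Q i, mgr_rank R i).
Hypothesis phi_homog : forall i,
  homog_mx (fun p => (@mgr_deg _ _ _ Q i p + e)%N) (@mgr_deg _ _ _ R i) (phi i).
Hypothesis phi_aug :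
  forall p q, I ((g *: mgr_aug Q - phi 0%N *m mgr_aug R) p q).
Hypothesis phi_diff :
  forall i, mgr_diff Q i *m phi i = phi i.+1 *m mgr_diff R i.

Definition cone_rank i := (mgr_rank R i + shift_rank (mgr_rank Q) i)%N.

(** The shift is [e.+1]: [phi] accounts for [e] and the factor ['X_x] for one more. *)
Definition cone_deg i (p : 'I_(cone_rank i)) : nat :=
  match split p with
  | inl p => mgr_deg p
  | inr p => @shift_deg (mgr_rank Q) (@mgr_deg _ _ _ Q) e.+1 i p
  end.

Definition cone_aug : 'cV[{mpoly k[n]}]_(cone_rank 0) := col_mx (mgr_aug R) 0.

Definition cone_diff i : 'M[{mpoly k[n]}]_(cone_rank i.+1, cone_rank i) :=
  block_mx (mgr_diff R i) 0
    ('X_x *: phi i : 'M_(shift_rank (mgr_rank Q) i.+1, _))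
    (shift_diff (mgr_diff Q) i).

Lemma msupp_X_phi i p q m : m \in msupp (('X_x *: phi i) p q) ->
  (mdeg m + mgr_deg q)%N = (mgr_deg p + e.+1)%N /\ m x != 0%N.
Proof.
rewrite mxE => /msuppM_le /allpairsP[[m1 m2] /= [+ /phi_homog hm ->]].
rewrite msuppX inE => /eqP ->; split; last by rewrite mnmDE mnm1E eqxx.
by rewrite mdegD mdeg1 -addnA hm addnS.
Qed.

Lemma cone_aug_homog (q : 'I_(cone_rank 0)) m :
  m \in msupp (cone_aug q 0) -> mdeg m = cone_deg q.
Proof.
rewrite /cone_aug /cone_deg mxE; case: (split q) => p; first by move/mgr_aug_homog.
by case: p.
Qed.

Lemma cone_diff_homog i (p : 'I_(cone_rank i.+1)) (q : 'I_(cone_rank i)) m :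
  m \in msupp (cone_diff i p q) -> (mdeg m + cone_deg q)%N = cone_deg p.
Proof.
rewrite /cone_diff /cone_deg !mxE; case: (split p) => p'; rewrite !mxE.
  case: (split q) => q'; first by move/mgr_diff_homog.
  by rewrite mxE msupp0.
case: (split q) => q' /=; first by case/msupp_X_phi.
case: i p q p' q' => [|i] p q p' q'; first by case: q'.
rewrite mxE (perm_mem (msuppN _)) /= => /mgr_diff_homog <-.
by rewrite addnA.
Qed.

Lemma cone_minimal i (p : 'I_(cone_rank i.+1)) (q : 'I_(cone_rank i)) :
  (cone_diff i p q)@_0%MM = 0.
Proof.
rewrite /cone_diff !mxE; case: (split p) => p'; rewrite !mxE.
  by case: (split q) => q'; rewrite ?mgr_minimal // mxE mcoeff0.
case: (split q) => q' /=.
  apply: memN_msupp_eq0; apply/negP => h0.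
  by have [_] := msupp_X_phi h0; rewrite mnm0E eqxx.
case: i p q p' q' => [|i] p q p' q'; first by case: q'.
by rewrite mxE mcoeffN mgr_minimal oppr0.
Qed.

Lemma mul_cone_aug (v : 'rV_(cone_rank 0)) :
  v *m cone_aug = lsubmx v *m mgr_aug R.
Proof. by rewrite -{1}[v]hsubmxK mul_row_col mulmx0 addr0. Qed.

Lemma cone_aug_surj f : exists v : 'rV_(cone_rank 0), J (f - (v *m cone_aug) 0 0).
Proof.
have [v hv] := mgr_aug_surj R f; exists (row_mx v 0).
by rewrite mul_cone_aug row_mxKl; apply/hJ; exists 0; rewrite mul0r subr0.
Qed.

Lemma mul_phi_aug (c : 'rV_(mgr_rank Q 0)) :
  I ((c *m phi 0%N *m mgr_aug R) 0 0 - g * (c *m mgr_aug Q) 0 0).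
Proof.
have -> : (c *m phi 0%N *m mgr_aug R) 0 0 - g * (c *m mgr_aug Q) 0 0 =
    - (c *m (g *: mgr_aug Q - phi 0%N *m mgr_aug R)) 0 0.
  by rewrite mulmxBr -scalemxAr mulmxA !mxE opprB.
by apply: ideal_opp => //; apply: ideal_mulmx.
Qed.

Lemma cone_exact0 (v : 'rV_(cone_rank 0)) :
  J ((v *m cone_aug) 0 0) <->
  exists w : 'rV_(cone_rank 1), v = w *m cone_diff 0.
Proof.
rewrite mul_cone_aug hJ; split.
  (* [c] represents [s] in S/K, so subtracting ['X_x] times its image under [phi] leaves an element
     with augmentation in [I]. *)
  case=> s Is; have [c hc] := mgr_aug_surj Q s.
  have [w hw] : exists w, lsubmx v - 'X_x *: (c *m phi 0%N) = w *m mgr_diff R 0.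
    apply/mgr_exact0.
    rewrite mulmxBl -scalemxAl [X in I X]mxE [X in _ + X]mxE [X in _ - X]mxE.
    set u := (_ *m _) 0 0 in Is *; set y := (_ *m mgr_aug R) 0 0.
    set z := (c *m mgr_aug Q) 0 0 in hc.
    have -> : u - 'X_x * y =
        (u - s * ('X_x * g)) + 'X_x * (g * (s - z)) - 'X_x * (y - g * z) by ring.
    apply: ideal_add => //.
      by apply: ideal_add => //; apply: ideal_mul => //; apply: hKg.
    by apply: ideal_opp => //; apply: ideal_mul => //; apply: mul_phi_aug.
  exists (row_mx w c); rewrite /cone_diff mul_row_block0 row_mxKl row_mxKr -hw.
  rewrite -scalemxAr subrK -[v]hsubmxK; congr row_mx; last first.
    by rewrite [LHS]thinmx0 [RHS]thinmx0.
  by rewrite row_mxKl.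
case=> w ->; rewrite /cone_diff mul_row_block0 row_mxKl.
exists ((rsubmx w *m mgr_aug Q) 0 0).
rewrite mulmxDl -scalemxAr -scalemxAl [X in X - _]mxE [X in _ + X - _]mxE.
have := mul_phi_aug (rsubmx w); set y := (rsubmx w *m _ *m _) 0 0.
set z := (rsubmx w *m mgr_aug Q) 0 0; set u := (_ *m _ *m mgr_aug R) 0 0.
have Iu : I u by apply/mgr_exact0; exists (lsubmx w).
move=> Iy; have -> : u + 'X_x * y - z * ('X_x * g) = u + 'X_x * (y - g * z) by ring.
by apply: ideal_add => //; apply: ideal_mul => //.
Qed.

Lemma cone_exact i (v : 'rV_(cone_rank i.+1)) :
  v *m cone_diff i = 0 <->
  exists w : 'rV_(cone_rank i.+2), v = w *m cone_diff i.+1.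
Proof.
rewrite /cone_diff mul_row_block0; split.
  move/eqP; rewrite row_mx_eq0 => /andP[/eqP h1 /eqP h2].
  have [c hc] : exists c : 'rV_(mgr_rank Q i.+1), rsubmx v = c *m mgr_diff Q i.
    (* For positive [i] the second component is a cycle. For [i] = 0 its augmentation times
       ['X_x * g] lies in [I], and multiplication by ['X_x * g] is injective on S/K. *)
    case: i v h1 h2 => [|i] v h1 h2; last first.
      by apply/mgr_exact/eqP; rewrite -oppr_eq0 -mulmxN; apply/eqP.
    apply/mgr_exact0/hgK.
    have := mul_phi_aug (rsubmx v); set y := (rsubmx v *m _ *m _) 0 0.
    set z := (rsubmx v *m mgr_aug Q) 0 0; set u := (lsubmx v *m mgr_diff R 0 *m mgr_aug R) 0 0.
    have Iu : I u by apply/mgr_exact0; exists (lsubmx v).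
    have eu : u = - ('X_x * y).
      move/eqP: h1; rewrite addr_eq0 => /eqP h1; rewrite /u h1 mulNmx mxE.
      by rewrite -scalemxAr -scalemxAl mxE.
    move=> Iy; have -> : 'X_x * g * z = - (u + 'X_x * (y - g * z)) by rewrite eu; ring.
    by apply: ideal_opp => //; apply: ideal_add => //; apply: ideal_mul => //.
  have [w hw] : exists w, lsubmx v + 'X_x *: (c *m phi i.+1) = w *m mgr_diff R i.+1.
    apply/mgr_exact; rewrite mulmxDl -scalemxAl -mulmxA -phi_diff mulmxA -hc.
    by rewrite scalemxAr.
  exists (row_mx w (- c)); rewrite mul_row_block0 row_mxKl row_mxKr -hw.
  rewrite -scalemxAr mulNmx scalerN addrK -[LHS]hsubmxK; congr row_mx.
  by rewrite mulNmx mulmxN opprK.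
case=> w ->; rewrite mul_row_block0 row_mxKl row_mxKr.
apply/eqP; rewrite row_mx_eq0; apply/andP; split; apply/eqP.
  rewrite mulmxDl -[_ *m mgr_diff R i.+1 *m _]mulmxA mgr_diff_comp mulmx0 add0r.
  rewrite -scalemxAr -scalemxAl -[_ *m phi i.+1 *m _]mulmxA -phi_diff /= mulmxN.
  by rewrite mulNmx -scalemxAr mulmxA subrr.
case: i {v} w => [|i] w; first by rewrite [LHS]thinmx0.
by rewrite /= -mulmxA !(mulNmx, mulmxN) opprK mgr_diff_comp mulmx0.
Qed.

Definition cone : resolution J :=
  MinimalGradedResolution cone_aug_homog cone_diff_homog cone_aug_surj
    cone_exact0 cone_exact cone_minimal.

Lemma cone_degP i j :
  (exists p : 'I_(mgr_rank cone i), mgr_deg p = j) <->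
  (exists p : 'I_(mgr_rank R i), mgr_deg p = j) \/
  exists i' j', [/\ i = i'.+1, j = (j' + e.+1)%N &
    exists p : 'I_(mgr_rank Q i'), mgr_deg p = j'].
Proof.
split=> [[p]|].
  rewrite /= /cone_deg; case: (split p) => q hq; first by left; exists q.
  case: i p q hq => [|i] p q hq; first by case: q hq.
  by right; exists i, (mgr_deg q); split=> //; exists q.
case=> [[p hp]|[i' [j' [ei ej [p hp]]]]].
  by exists (lshift _ p); rewrite /= /cone_deg (unsplitK (inl p)).
subst i; exists (rshift (mgr_rank R i'.+1) (p : 'I_(shift_rank _ i'.+1))).
by rewrite /= /cone_deg (unsplitK (inr p)) /= hp.
Qed.

End Cone.
(** Multiplication by ['X_x * g] gives an exact sequence 0 -> S/K(-e-1) -> S/I -> S/J -> 0. As [g]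
    alone maps [K] into [I], the comparison map is divisible by ['X_x], so the cone is minimal and
    no shifts cancel. *)
Lemma mapping_cone I J K (R : resolution I) (Q : resolution K) x g e :
  homogeneous_ideal I -> (forall m, m \in msupp g -> mdeg m = e) ->
  (forall f, K f -> I (g * f)) -> (forall f, I ('X_x * g * f) -> K f) ->
  (forall f, J f <-> exists s, I (f - s * ('X_x * g))) ->
  exists C : resolution J, forall i j,
  (exists p : 'I_(mgr_rank C i), mgr_deg p = j) <->
  (exists p : 'I_(mgr_rank R i), mgr_deg p = j) \/
  exists i' j', [/\ i = i'.+1, j = (j' + e.+1)%N &
    exists p : 'I_(mgr_rank Q i'), mgr_deg p = j'].
Proof.
move=> hI hg hKg hgK hJ; have [phi [h1 h2 h3]] := chain_map R Q hI hKg hg.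
by exists (cone hI hKg hgK hJ h1 h2 h3) => i j; apply: cone_degP.
Qed.

End MappingCone.

(** * Squarefree monomial ideals *)

(** Generates the colon ideal (E : m_A); it may contain the empty set or comparable members even if
    [E] is an antichain. *)
Definition localize (n : nat) (A : {set 'I_n}) (E : {set {set 'I_n}}) :
    {set {set 'I_n}} := [set F :\: A | F in E].

Section MonomialIdeals.

Local Open Scope ring_scope.
Variables (k : fieldType) (n : nat).
Implicit Types (f g s : {mpoly k[n]}) (m : 'X_{1..n}).
Implicit Types (A F G : {set 'I_n}) (E : {set {set 'I_n}}).

Definition msupport m : {set 'I_n} := [set x | m x != 0%N].

Definition mset F : 'X_{1..n} := [multinom (x \in F : nat) | x < n].

(** Membership is decided monomial by monomial; the generators being squarefree, m_F divides a
    monomial exactly when [F] lies in its support. *)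
Definition monomial_ideal E f : Prop :=
  forall m, m \in msupp f -> exists2 F, F \in E & F \subset msupport m.

Notation resolution := (@minimal_graded_resolution k n).

Lemma msupportD m m' : msupport (m + m') = msupport m :|: msupport m'.
Proof. by apply/setP => x; rewrite !inE mnmDE addn_eq0 negb_and. Qed.

Lemma msupport_mset F : msupport (mset F) = F.
Proof. by apply/setP => x; rewrite inE mnmE; case: (x \in F). Qed.

Lemma mset_le F m : F \subset msupport m -> (mset F <= m)%MM.
Proof.
move/subsetP => Fm; apply/mnm_lepP => x; rewrite mnmE.
by case: (boolP (x \in F)) => // /Fm; rewrite inE lt0n.
Qed.

Lemma mdeg_mset F : mdeg (mset F) = #|F|.
Proof.
rewrite mdegE -sum1_card [RHS]big_mkcond; apply: eq_bigr => x _.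
by rewrite mnmE; case: (x \in F).
Qed.

Lemma prod_mset F : \prod_(x in F) 'X_x = 'X_[mset F] :> {mpoly k[n]}.
Proof.
rewrite [RHS]mpolyXE_id big_mkcond; apply: eq_bigr => x _; rewrite mnmE.
by case: (x \in F); rewrite ?expr1 ?expr0.
Qed.

Lemma mset_setD1 x F : x \in F -> 'X_x * 'X_[mset (F :\ x)] = 'X_[mset F] :> {mpoly k[n]}.
Proof. by move=> xF; rewrite -!prod_mset -big_setD1. Qed.

Lemma monomial_ideal_homog E : homogeneous_ideal (monomial_ideal E).
Proof.
split=> [m|f g hf hg m|f g hg m|s t f hf m].
- by rewrite msupp0.
- by move=> /msuppD_le; rewrite mem_cat => /orP[/hf|/hg].
- move=> /msuppM_le /allpairsP[[m1 m2] /= [_ /hg [F FE Fm] ->]].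
  by exists F => //; rewrite msupportD subsetU // Fm orbT.
- by rewrite msupp_hpart => /andP[/hf].
Qed.

Lemma monomial_idealX E F : F \in E -> monomial_ideal E 'X_[mset F].
Proof.
by move=> FE m; rewrite msuppX inE => /eqP ->; exists F; rewrite ?msupport_mset.
Qed.

Lemma mfilter_split (P : pred 'X_{1..n}) f : f = mfilter P f + mfilter (predC P) f.
Proof.
apply/mpolyP => m; rewrite mcoeffD !mcoeff_mfilter /=.
by case: (P m); rewrite ?addr0 ?add0r.
Qed.

Lemma mfilter_dvd (P : pred 'X_{1..n}) f F : (forall m, P m -> F \subset msupport m) ->
  exists s, mfilter P f = s * 'X_[mset F].
Proof.
move=> hP; exists (\sum_(m <- msupp f | P m) f@_m *: 'X_[m - mset F]).
rewrite /mfilter mulr_suml; apply: eq_bigr => m /hP /mset_le Fm.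
by rewrite -scalerAl -mpolyXD submK.
Qed.

(** An equality of predicates, so that it can be rewritten inside the type of resolutions. *)
Lemma facet_idealE D : facet_ideal (k := k) D = monomial_ideal (facets D).
Proof.
apply: functional_extensionality => f; apply: propositional_extensionality.
have hI := monomial_ideal_homog (facets D); split.
  case=> c ->; elim/big_ind: _ => [|f1 f2|F FD].
  - by case: hI.
  - exact: (ideal_add hI).
  by rewrite prod_mset; apply: (ideal_mul _ hI); apply: monomial_idealX.
move=> hf; rewrite [f]mpolyE big_seq; elim/big_ind: _ => [|f1 f2|m mf].
- by exists (fun=> 0); rewrite big1 // => F _; rewrite mul0r.
- case=> c1 -> [c2 ->]; exists (fun F => c1 F + c2 F).
  by rewrite -big_split; apply: eq_bigr => F _; rewrite mulrDl.
have [F FD Fm] := hf m mf.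
exists (fun G => if G == F then f@_m *: 'X_[m - mset F] else 0).
rewrite (bigD1 F) //= eqxx prod_mset -scalerAl -mpolyXD submK; last exact: mset_le.
by rewrite big1 ?addr0 // => G /andP[_ /negPf ->]; rewrite mul0r.
Qed.

Lemma eq_monomial_ideal E E' :
  (forall F, F \in E -> exists2 G, G \in E' & G \subset F) ->
  (forall F, F \in E' -> exists2 G, G \in E & G \subset F) ->
  monomial_ideal E = monomial_ideal E'.
Proof.
move=> h h'; apply: functional_extensionality => f.
apply: propositional_extensionality; split=> hf m /hf [F].
  by case/h => G GE GF Fm; exists G => //; apply: subset_trans Fm.
by case/h' => G GE GF Fm; exists G => //; apply: subset_trans Fm.
Qed.

Lemma monomial_ideal_colon E A f :
  monomial_ideal E ('X_[mset A] * f) <-> monomial_ideal (localize A E) f.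
Proof.
have key F m : (F \subset msupport (mset A + m)) = (F :\: A \subset msupport m).
  by rewrite msupportD msupport_mset subDset.
split=> h m.
  move=> mf; have : (mset A + m)%MM \in msupp ('X_[mset A] * f).
    by rewrite mulrC (perm_mem (msuppMX _ _)) map_f.
  case/h => F FE; rewrite key => FA; exists (F :\: A) => //.
  exact: imset_f.
rewrite mulrC (perm_mem (msuppMX _ _)) => /mapP[m' /h [_ /imsetP[F FE ->] FA] ->].
by exists F; rewrite ?key.
Qed.

(** The monomials of [f] divisible by m_F form a multiple of m_F; every other one must be divisible
    by a generator from [E]. *)
Lemma monomial_idealU1 E F f :
  monomial_ideal (F |: E) f <->
  exists s, monomial_ideal E (f - s * 'X_[mset F]).
Proof.
split=> [hf|[s hs]].
  pose P m := F \subset msupport m.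
  have [s hs] := @mfilter_dvd P f F (fun m Fm => Fm); exists s.
  rewrite -hs {1}(mfilter_split P f) addrC addKr => m.
  rewrite mcoeff_msupp mcoeff_mfilter /=; case: ifP; last by rewrite eqxx.
  rewrite /P => FmN; rewrite -mcoeff_msupp => /hf [G]; rewrite !inE.
  by case/orP => [/eqP-> Fm|GE Gm]; [rewrite Fm in FmN | exists G].
have hI := monomial_ideal_homog (F |: E).
rewrite -(subrK (s * 'X_[mset F]) f); apply: (ideal_add hI).
  by move=> m /hs [G GE Gm]; exists G => //; rewrite !inE GE orbT.
by apply: (ideal_mul _ hI); apply: monomial_idealX; rewrite setU11.
Qed.

(** * Nonvanishing of graded Betti numbers *)

Definition resolvable E : Prop := inhabited (resolution (monomial_ideal E)).

Definition has_betti E i j : Prop :=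
  exists R : resolution (monomial_ideal E),
  exists p : 'I_(mgr_rank R i), mgr_deg p = j.

Lemma has_bettiP E (R : resolution (monomial_ideal E)) i j :
  has_betti E i j <-> exists p : 'I_(mgr_rank R i), mgr_deg p = j.
Proof.
split=> [[R' hR']|hR]; last by exists R.
exact: mgr_deg_unique (monomial_ideal_homog E) hR'.
Qed.

(** Resolvability makes the predicate under [epsilon] satisfiable, so the chosen number is counted
    on an actual resolution. *)
Lemma betti_neq0 D i j : resolvable (facets D) ->
  betti k D i j <> 0%N <-> has_betti (facets D) i j.
Proof.
case=> R; rewrite /betti facet_idealE /graded_betti.
set P := (fun b : nat => _).
have [R' ->] : P (epsilon (inhabits 0%N) P).
  by apply: epsilon_spec; exists #|[set p : 'I_(mgr_rank R i) | mgr_deg p == j]|; exists R.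
rewrite (has_bettiP R'); split.
  by move/eqP; rewrite cards_eq0 => /set0Pn[p]; rewrite inE => /eqP hp; exists p.
by case=> p hp; apply/eqP; rewrite cards_eq0; apply/set0Pn; exists p; rewrite inE hp.
Qed.

Lemma eq_has_betti E E' : monomial_ideal E = monomial_ideal E' ->
  forall i j, has_betti E i j <-> has_betti E' i j.
Proof. by rewrite /has_betti => ->. Qed.

Lemma unit_ideal_resolution E : set0 \in E ->
  exists R : resolution (monomial_ideal E), forall i, mgr_rank R i = 0%N.
Proof.
move=> E0; have hE f : monomial_ideal E f by move=> m _; exists set0; rewrite ?sub0set.
unshelve eexists (@MinimalGradedResolution k n _ (fun=> 0%N) (fun _ _ => 0%N) 0 (fun=> 0)
  _ _ _ _ _ _) => //=.
- by case.
- by move=> i [].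
- by move=> f; exists 0.
- by move=> v; split=> // _; exists 0; rewrite [LHS]thinmx0 [RHS]thinmx0.
- by move=> i v; rewrite [v]thinmx0 mul0mx; split=> // _; exists 0; rewrite mul0mx.
- by move=> i [].
Qed.

Lemma has_betti_unit E i j : set0 \in E -> ~ has_betti E i j.
Proof.
case/unit_ideal_resolution => R hR; rewrite (has_bettiP R) => -[p _].
by move: p; rewrite hR => -[].
Qed.

Lemma zero_ideal_resolution :
  exists R : resolution (monomial_ideal set0),
  forall i j, (exists p : 'I_(mgr_rank R i), mgr_deg p = j) <-> i = 0%N /\ j = 0%N.
Proof.
have hE f : monomial_ideal set0 f <-> f = 0.
  split=> [hf|->]; last by move=> m; rewrite msupp0.
  apply/eqP; rewrite -msupp_eq0; case e: (msupp f) => [//|m s].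
  by have := hf m; rewrite e => /(_ (mem_head _ _))[F]; rewrite inE.
(* The boolean [i == 0%N] is read as a rank: one generator in homological degree 0 and none
   above. *)
unshelve eexists (@MinimalGradedResolution k n _ (fun i => i == 0%N) (fun _ _ => 0%N)
   (const_mx 1) (fun=> 0) _ _ _ _ _ _) => //=.
- by move=> q m; rewrite mxE msupp1 inE => /eqP ->; rewrite mdeg0.
- by move=> i [].
- by move=> f; exists (const_mx f); apply/hE; rewrite mxE big_ord1 !mxE mulr1 subrr.
- move=> v; rewrite hE mxE big_ord1 mxE mulr1; split=> [v0|[w ->]].
    exists 0; rewrite mul0mx; apply/rowP => j; rewrite ord1 v0 mxE //.
  by rewrite mulmx0 mxE.
- move=> i v; rewrite [v]thinmx0; split=> [_|_]; last by rewrite mul0mx.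
  by exists 0; rewrite mul0mx.
- by move=> i [].
- move=> i j; split=> [[p <-]|[-> ->]]; last by exists ord0.
  by case: i p => // i [].
Qed.

Lemma has_betti0 i j : has_betti set0 i j <-> i = 0%N /\ j = 0%N.
Proof. by have [R <-] := zero_ideal_resolution; rewrite (has_bettiP R). Qed.

Lemma localize_setD1 x F E : x \notin cover E ->
  localize (F :\ x) E = localize F E.
Proof.
move=> xE; apply: eq_in_imset => G GE; apply/setP => y; rewrite !inE.
case: eqP => //= ->; rewrite andbC; case: (boolP (x \in G)) => // xG.
by case/bigcupP: xE; exists G.
Qed.

(* Since [x] does not divide the generators from [E], multiplication by
   [m_F / x] already maps [S / (E : m_F)] to [S / E]; multiplying a lift of it
   by [x] gives a comparison map whose mapping cone is minimal. *)
Lemma has_betti_free_vertex E F x : x \in F -> x \notin cover E ->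
  resolvable E -> resolvable (localize F E) ->
  resolvable (F |: E) /\ forall i j,
  has_betti (F |: E) i j <-> has_betti E i j \/
  exists i' j', [/\ i = i'.+1, j = (j' + #|F|)%N & has_betti (localize F E) i' j'].
Proof.
move=> xF xE [R] [Q]; set g : {mpoly k[n]} := 'X_[mset (F :\ x)].
have Xg : 'X_x * g = 'X_[mset F] by apply: mset_setD1.
have [] := @mapping_cone k n _ (monomial_ideal (F |: E)) _ R Q x g #|F :\ x|.
- exact: monomial_ideal_homog.
- by move=> m; rewrite msuppX inE => /eqP ->; rewrite mdeg_mset.
- by move=> f; rewrite -(localize_setD1 _ xE) => /monomial_ideal_colon.
- by move=> f; rewrite Xg => /monomial_ideal_colon.
- by move=> f; rewrite Xg; apply: monomial_idealU1.
move=> C hC; split=> [|i j]; first by exists.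
rewrite (has_bettiP C) hC (has_bettiP R) (cardsD1 x F) xF add1n.
by split=> -[h|[i' [j' [-> -> h]]]]; [left | right | left | right] => //;
  exists i', j'; split=> //; apply/(has_bettiP Q).
Qed.

End MonomialIdeals.

(** * Hyperforests *)

Section Forests.

Variable n : nat.
Implicit Types (A B F G H V u w : {set 'I_n}) (E M : {set {set 'I_n}}) (x y : 'I_n).

Definition has_joint E F : Prop :=
  exists G, [/\ G \in E, G != F &
    forall H, H \in E -> H != F -> F :&: H \subset G].

(** The forest condition for arbitrary families, since localizing an antichain need not give an
    antichain. *)
Definition hyperforest E : Prop :=
  forall E', E' \subset E -> E' != set0 ->
  exists F, F \in E' /\ (E' = [set F] \/ has_joint E' F).

Definition antichain E : Prop :=
  forall F G, F \in E -> G \in E -> F \subset G -> F = G.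

Definition minimals E : {set {set 'I_n}} :=
  [set F in E | [forall G in E, (G \subset F) ==> (G == F)]].

Lemma minimals_sub E : minimals E \subset E.
Proof. by apply/subsetP => F; rewrite inE => /andP[]. Qed.

Lemma antichain_minimals E : antichain (minimals E).
Proof.
move=> F G; rewrite !inE => /andP[FE _] /andP[_ /forall_inP/(_ F FE)/implyP h].
by move/h/eqP.
Qed.

Lemma minimals_below E F : F \in E -> exists2 G, G \in minimals E & G \subset F.
Proof.
move=> FE; pose P G := (G \in E) && (G \subset F).
have PF : P F by rewrite /P FE subxx.
case: (arg_minnP (fun G => #|G|) PF) => G /andP[GE GF] Gmin.
exists G => //; rewrite inE GE; apply/forall_inP => H HE; apply/implyP => HG.
by rewrite eqEcard HG Gmin // /P HE (subset_trans HG).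
Qed.

Lemma hyperforestS E E' : E' \subset E -> hyperforest E -> hyperforest E'.
Proof. by move=> sE hE E'' /subset_trans/(_ sE); apply: hE. Qed.

Lemma hyperforestD1 E F : hyperforest E -> hyperforest (E :\ F).
Proof. exact/hyperforestS/subsetDl. Qed.

(** A leaf of a family of chosen preimages maps to a leaf, because F ∩ H ⊆ G survives the removal of
    [A]. *)
Lemma hyperforest_localize A E : hyperforest E -> hyperforest (localize A E).
Proof.
move=> hE E' /subsetP sE' E'0.
have lift F' : F' \in E' -> exists2 F, F \in E & F' = F :\: A.
  by move/sE'/imsetP.
pose c F' := odflt set0 [pick F in E | F' == F :\: A].
have cP F' : F' \in E' -> c F' \in E /\ F' = c F' :\: A.
  move/lift => [F FE ->]; rewrite /c; case: pickP => [G /andP[GE /eqP]//|].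
  by move/(_ F); rewrite FE eqxx.
have [||F [FE hF]] := hE [set c F' | F' in E'].
- by apply/subsetP => _ /imsetP[F' /cP[cE _] ->].
- by have /set0Pn[F' FE'] := E'0; apply/set0Pn; exists (c F'); apply: imset_f.
have [F' F'E eF] := imsetP FE; rewrite {F}eF in FE hF.
exists F'; split => //; case: hF => [hF|[_ [/imsetP[G' G'E ->] GF hG]]]; [left | right].
  apply/setP => G'; rewrite inE; apply/idP/eqP => [G'E|-> //].
  have : c G' \in [set c F']  by rewrite -hF imset_f.
  by rewrite inE => /eqP e; rewrite (cP _ G'E).2 e -(cP _ F'E).2.
exists G'; split=> // [|H' H'E H'F].
  by apply: contraNneq GF => ->.
rewrite (cP _ F'E).2 (cP _ H'E).2 (cP _ G'E).2 -setDIl setSD //.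
apply: hG; first exact: imset_f.
apply: contraNneq H'F => e; by rewrite (cP _ H'E).2 e -(cP _ F'E).2.
Qed.

Lemma card_localize_lt A E F : F \in E -> #|localize A (E :\ F)| < #|E|.
Proof.
move=> FE; apply: leq_ltn_trans (leq_imset_card _ _) _.
by rewrite (cardsD1 F E) FE.
Qed.

Lemma coverS E E' : E' \subset E -> cover E' \subset cover E.
Proof.
move/subsetP => sE; apply/bigcupsP => F /sE FE; exact: (bigcup_max F).
Qed.

Lemma cover_localize A E V : cover E \subset V -> cover (localize A E) \subset V :\: A.
Proof.
move/bigcupsP => hE; apply/bigcupsP => _ /imsetP[F FE ->]; exact/setSD/hE.
Qed.

Lemma localizeU A B E : localize A (localize B E) = localize (A :|: B) E.
Proof. by rewrite /localize -imset_comp; apply: eq_imset => F /=; rewrite setDDl setUC. Qed.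

(** The antichain condition gives a vertex of [F] outside the joint, while every other member meets
    [F] inside the joint. *)
Lemma joint_free_vertex E F : antichain E -> F \in E -> has_joint E F ->
  exists2 y, y \in F & y \notin cover (E :\ F).
Proof.
move=> aE FE [G [GE GF hG]].
have /subsetPn[y yF yG] : ~~ (F \subset G).
  by apply: contraNN GF => /aE-> //.
exists y => //; apply: contra yG => /bigcupP[H]; rewrite !inE => /andP[HF HE] yH.
by apply: (subsetP (hG H HE HF)); rewrite inE yF.
Qed.

Lemma exists_free_vertex E : antichain E -> hyperforest E -> E != set0 ->
  set0 \notin E -> exists F y, [/\ F \in E, y \in F & y \notin cover (E :\ F)].
Proof.
move=> aE hE E0 nE; have [F [FE hF]] := hE E (subxx _) E0; case: hF => hF.
  have /set0Pn[y yF] : F != set0 by apply: contraNneq nE => <-.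
  by exists F, y; split=> //; rewrite hF setDv /cover big_set0 inE.
by have [y yF yE] := joint_free_vertex aE FE hF; exists F, y.
Qed.

(** If the leaf found is [F0], delete it and take a leaf [L] other than its joint [G], with joint
    L'. Then L ∩ F0 ⊆ L ∩ G ⊆ L', so [L] is still a leaf when [F0] is put back. *)
Lemma exists_leaf_neq E F0 : hyperforest E -> 1 < #|E| ->
  exists F, [/\ F \in E, F != F0 & has_joint E F].
Proof.
move: {2}_.+1 (ltnSn #|E|) => N; elim: N E F0 => // N IH E F0 leN hE E1.
have E0 : E != set0 by rewrite -card_gt0 (ltn_trans _ E1).
have [F [FE]] := hE E (subxx _) E0; case=> [eE|hF].
  by rewrite eE cards1 in E1.
have [FF0|FF0] := eqVneq F F0; last by exists F.
have [G [GE GF hG]] := hF; rewrite FF0 in FE GF hF hG => {F FF0}.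
have cE : #|E| = #|E :\ F0|.+1 by rewrite (cardsD1 F0 E) FE.
have GE' : G \in E :\ F0 by rewrite !inE GF.
have [E'1|E'1] := leqP #|E :\ F0| 1.
  exists G; split=> //; exists F0; split=> //; first by rewrite eq_sym.
  move=> H HE HG; have [-> //|HF0] := eqVneq H F0; first exact: subsetIr.
  have HE' : H \in E :\ F0 by rewrite !inE HF0.
  by have := card_le1P E'1 G GE' H; rewrite HE' inE (negPf HG).
have [|L [LE LG [L' [L'E L'L hL']]]] := IH (E :\ F0) G _ (hyperforestD1 hE) E'1.
  by rewrite -ltnS -cE.
have [LF0 LE0] := setD1P LE; exists L; split=> //; exists L'; split=> //.
  by have [] := setD1P L'E.
move=> H HE HL; have [->|HF0] := eqVneq H F0; last by apply: hL'; rewrite ?inE ?HF0.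
apply: subset_trans (hL' G GE' _); last by rewrite eq_sym.
by rewrite subsetI subsetIl setIC hG.
Qed.

Lemma exists_free_vertex_neq E x : antichain E -> hyperforest E -> 1 < #|E| ->
  exists F y, [/\ F \in E, y \in F, y != x & y \notin cover (E :\ F)].
Proof.
(* A leaf other than some member containing [x] cannot have [x] as a free vertex; if no member
   contains [x], the default is harmless. *)
move=> aE hE E1; pose F0 := odflt set0 [pick F in E | x \in F].
have [F [FE FF0 jF]] := exists_leaf_neq F0 hE E1.
have [y yF yE] := joint_free_vertex aE FE jF; exists F, y; split=> //.
apply: contraNneq yE => yx; apply/bigcupP; exists F0; rewrite {y}yx in yF *.
  rewrite !inE eq_sym FF0 /F0; case: pickP => [G /andP[]//|/(_ F)].
  by rewrite FE yF.
by rewrite /F0; case: pickP => [G /andP[]//|/(_ F)]; rewrite FE yF.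
Qed.

End Forests.

(** * Betti numbers of hyperforests *)

Section BettiForests.

Variables (k : fieldType) (n : nat).
Implicit Types (A B F G H V u w : {set 'I_n}) (E M : {set {set 'I_n}}) (x y : 'I_n).
Implicit Types (i j : nat).

Local Notation nz := (has_betti k).

(** The inductions on the number of generators below first pass to the minimal members, which form
    an antichain. *)
Lemma monomial_ideal_minimals E : monomial_ideal (k := k) (minimals E) = monomial_ideal E.
Proof.
apply: eq_monomial_ideal => F; last exact: minimals_below.
by move/(subsetP (minimals_sub E)); exists F.
Qed.

Lemma monomial_ideal_localize_minimals A E :
  monomial_ideal (k := k) (localize A (minimals E)) = monomial_ideal (localize A E).
Proof.
apply: eq_monomial_ideal => _ /imsetP[F FE ->].
  by exists (F :\: A) => //; apply/imset_f/(subsetP (minimals_sub E)).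
have [G GE GF] := minimals_below FE; exists (G :\: A); first exact: imset_f.
exact: setSD.
Qed.

Lemma monomial_ideal_restrict_minimals E w :
  monomial_ideal (k := k) (minimals E ::&: w) = monomial_ideal (E ::&: w).
Proof.
apply: eq_monomial_ideal => F; rewrite !inE => /andP[FE Fw].
  by exists F; rewrite ?inE ?Fw ?andbT //; apply: (subsetP (minimals_sub E)); rewrite inE.
have [G GE GF] := minimals_below FE; exists G => //.
by rewrite !inE in GE *; rewrite GE (subset_trans GF).
Qed.

(** Iterated mapping cones, starting from the zero and unit ideals: deleting a member with a free
    vertex, with or without localizing at it, leaves fewer members. *)
Lemma resolvable_hyperforest E : hyperforest E -> resolvable k E.
Proof.
move: {2}_.+1 (ltnSn #|E|) => N; elim: N E => // N IH E leN hE.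
rewrite /resolvable -monomial_ideal_minimals.
have hM : hyperforest (minimals E) := hyperforestS (minimals_sub E) hE.
have [M0|M0] := boolP (set0 \in minimals E).
  by have [R _] := unit_ideal_resolution k M0; exists.
have [->|Mn0] := eqVneq (minimals E) set0.
  by have [R _] := zero_ideal_resolution k n; exists.
have [F [y [FM yF yM]]] := exists_free_vertex (@antichain_minimals _ E) hM Mn0 M0.
have leM : #|minimals E| <= N.
  exact: leq_trans (subset_leq_card (minimals_sub E)) _.
have hM' := hyperforestD1 (F := F) hM.
have [] := @has_betti_free_vertex k n (minimals E :\ F) F y yF yM _ _.
- apply: (IH _ _ hM'); apply: leq_trans leM; by rewrite (cardsD1 F (minimals E)) FM.
- by apply: (IH _ _ (hyperforest_localize hM')); apply: leq_trans leM; apply: card_localize_lt.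
by rewrite /resolvable setD1K.
Qed.

Lemma has_betti_leaf E F y i j : hyperforest E ->
  F \in E -> y \in F -> y \notin cover (E :\ F) ->
  nz E i j <-> nz (E :\ F) i j \/
  exists i' j', [/\ i = i'.+1, j = j' + #|F| & nz (localize F (E :\ F)) i' j'].
Proof.
move=> hE FE yF yE; have hE' := hyperforestD1 (F := F) hE.
have := has_betti_free_vertex yF yE (resolvable_hyperforest hE')
  (resolvable_hyperforest (hyperforest_localize hE')).
by rewrite setD1K // => -[_]; apply.
Qed.

(** Splitting off [F] contributes #|F| and leaves a family on the other vertices. The bound replaces
    a multigrading: degree #|V| can occur only if all of [V] is covered. *)
Lemma has_betti_le_cover E i j : hyperforest E -> nz E i j -> j <= #|cover E|.
Proof.
move: {2}_.+1 (ltnSn #|E|) => N; elim: N E i j => // N IH E i j leN hE.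
rewrite -(eq_has_betti (monomial_ideal_minimals E)).
have hM : hyperforest (minimals E) := hyperforestS (minimals_sub E) hE.
have [M0|M0] := boolP (set0 \in minimals E); first by move/(has_betti_unit M0).
have [->|Mn0] := eqVneq (minimals E) set0; first by case/has_betti0 => _ ->.
have [F [y [FM yF yM]]] := exists_free_vertex (@antichain_minimals _ E) hM Mn0 M0.
have leM : #|minimals E| <= N.
  exact: leq_trans (subset_leq_card (minimals_sub E)) _.
have hM' := hyperforestD1 (F := F) hM.
have sM : cover (minimals E) \subset cover E by apply/coverS/minimals_sub.
move/(has_betti_leaf _ _ hM FM yF yM).
case=> [/IH -/(_ _ hM') h|[i' [j' [_ -> /IH h]]]].
  apply: leq_trans (h _) _; last first.
    exact: subset_leq_card (subset_trans (coverS (subsetDl _ _)) sM).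
  by apply: leq_trans leM; rewrite (cardsD1 F (minimals E)) FM.
have FE : F \subset cover E := subset_trans (bigcup_sup _ FM) sM.
rewrite -(cardsID F (cover E)) (setIidPr FE) addnC leq_add2l.
apply: leq_trans (h _ (hyperforest_localize hM')) _.
  by apply: leq_trans leM; apply: card_localize_lt.
apply/subset_leq_card/cover_localize.
exact: subset_trans (coverS (subsetDl _ _)) sM.
Qed.

Lemma has_betti_top_cover E V i : hyperforest E -> cover E \subset V ->
  nz E i #|V| -> cover E = V.
Proof.
move=> hE EV /(has_betti_le_cover hE) h.
by apply/eqP; rewrite eqEcard EV.
Qed.

(* Only the term of the mapping cone coming from [F] reaches the top degree,
   because the other one does not involve the free vertex of [F]. *)
Lemma has_betti_top_leaf E V F y i : hyperforest E -> cover E \subset V ->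
  F \in E -> y \in F -> y \notin cover (E :\ F) ->
  nz E i #|V| <->
  exists2 i', i = i'.+1 & nz (localize F (E :\ F)) i' #|V :\: F|.
Proof.
move=> hE EV FE yF yE; rewrite (has_betti_leaf _ _ hE FE yF yE).
have FV : F \subset V := subset_trans (bigcup_sup _ FE) EV.
have cV : #|V| = #|V :\: F| + #|F| by rewrite -(cardsID F V) (setIidPr FV) addnC.
split=> [[h|[i' [j' [-> e h]]]]|[i' -> h]]; last by right; exists i', #|V :\: F|.
  have E'V : cover (E :\ F) \subset V := subset_trans (coverS (subsetDl _ _)) EV.
  have e := has_betti_top_cover (hyperforestD1 hE) E'V h.
  by rewrite e (subsetP FV y yF) in yE.
by exists i' => //; move: e; rewrite cV => /addIn ->.
Qed.

(** * Restriction of families and its interplay with localization *)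

Lemma restrict_full E w : cover E \subset w -> E ::&: w = E.
Proof.
move=> Ew; apply/setP => F; rewrite !inE andb_idr // => FE.
exact: subset_trans (bigcup_sup _ FE) Ew.
Qed.

Lemma restrict_restrict E u w : u \subset w -> E ::&: w ::&: u = E ::&: u.
Proof.
move=> uw; apply/setP => F; rewrite !inE -andbA; congr (_ && _).
by rewrite andb_idl // => /subset_trans; apply.
Qed.

Lemma cover_restrict E w : cover (E ::&: w) \subset w.
Proof. by apply/bigcupsP => F; rewrite !inE => /andP[]. Qed.

Lemma restrict_sub E w : E ::&: w \subset E.
Proof. by apply/subsetP => F; rewrite inE => /andP[]. Qed.

Lemma hyperforest_restrict E w : hyperforest E -> hyperforest (E ::&: w).
Proof. exact/hyperforestS/restrict_sub. Qed.

Lemma localize_restrict E A w :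
  localize A E ::&: w = localize A (E ::&: (A :|: w)).
Proof.
apply/setP => G; rewrite !inE; apply/andP/imsetP.
  case=> /imsetP[F FE ->]; rewrite subDset => Fw.
  by exists F => //; rewrite !inE FE.
case=> F; rewrite !inE -subDset => /andP[FE Fw] ->.
by split=> //; apply: imset_f.
Qed.

(** The vertex [y] stays in F \ A and lies in no other localized member, so no other member
    collapses onto F \ A. *)
Lemma localize_setD E A F y : F \in E -> y \in F -> y \notin A ->
  y \notin cover (E :\ F) -> localize A E :\ (F :\: A) = localize A (E :\ F).
Proof.
move=> FE yF yA yE; apply/setP => G; rewrite !inE; apply/andP/imsetP.
  case=> GF /imsetP[H HE eG]; exists H => //; rewrite !inE HE andbT.
  by apply: contraNneq GF => <-; apply/eqP.
case=> H; rewrite !inE => /andP[HF HE] ->; split; last exact: imset_f.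
apply: contraNneq yE => /setP/(_ y); rewrite !inE yA yF /= => yH.
by apply/bigcupP; exists H; rewrite // !inE HF.
Qed.

Lemma cover_localize_sub A E : cover (localize A E) \subset cover E.
Proof. exact: subset_trans (cover_localize _ (subxx _)) (subsetDl _ _). Qed.

(* A facet with a free vertex different from [x] keeps that vertex free in both
   the localization at [x] and the restriction to [V :\ x], so it can be split
   off everywhere at once. *)
Lemma has_betti_localize1 E V x i : hyperforest E -> cover E \subset V ->
  nz (localize [set x] E) i #|V :\ x| ->
  nz E i #|V| \/ nz (E ::&: (V :\ x)) i #|V :\ x|.
Proof.
move: {2}_.+1 (ltnSn #|E|) => N; elim: N E V i => // N IH E V i leN hE EV.
rewrite -(eq_has_betti (monomial_ideal_localize_minimals _ E)).
rewrite -(eq_has_betti (monomial_ideal_minimals E)).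
rewrite -(eq_has_betti (monomial_ideal_restrict_minimals E _)).
have hM : hyperforest (minimals E) := hyperforestS (minimals_sub E) hE.
have aM := @antichain_minimals _ E.
have leM : #|minimals E| <= N.
  exact: leq_trans (subset_leq_card (minimals_sub E)) _.
have MV : cover (minimals E) \subset V := subset_trans (coverS (minimals_sub E)) EV.
move: (minimals E) hM aM leM MV => M hM aM leM MV hx.
have [M0|Mn0] := eqVneq M set0.
  rewrite M0 /localize imset0 in hx *.
  by right; rewrite restrict_full // /cover big_set0 sub0set.
have [G [y [GM yG yx yM]]] :
    exists G y, [/\ G \in M, y \in G, y != x & y \notin cover (M :\ G)].
  have [M1|M1] := leqP #|M| 1; last exact: exists_free_vertex_neq.
  (* A single member has a vertex other than [x], since otherwise localizing at [x] would give the
     unit ideal, which has no nonzero Betti number. *)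
  have /set0Pn[G GM] := Mn0; exists G.
  have eM : M = [set G].
    by apply/setP => H; rewrite (card_le1P M1 G GM H) inE.
  have [y] : exists y, y \in G :\ x.
    apply/set0Pn; apply/negP => /eqP G0; apply: (has_betti_unit _ hx).
    by rewrite -G0; apply: imset_f.
  rewrite !inE => /andP[yx yG]; exists y; split=> //.
  by rewrite eM setDv /cover big_set0 inE.
have GV : G \subset V := subset_trans (bigcup_sup _ GM) MV.
have hM' := hyperforestD1 (F := G) hM.
have yx1 : y \notin [set x] by rewrite inE.
have eMx := localize_setD GM yG yx1 yM.
(* Splitting off [G :\ x] after localizing at [x] is the same as splitting off [G] and then
   localizing at [x]. *)
have [i' ei] : exists2 i', i = i'.+1 &
    nz (localize [set x] (localize G (M :\ G))) i' #|(V :\: G) :\ x|.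
  have /(has_betti_top_leaf (y := y) (F := G :\ x) i (hyperforest_localize hM)) :=
    cover_localize [set x] MV.
  case/(_ _ _ _)/iffLR/(_ hx).
  - exact: imset_f.
  - by rewrite !inE yx.
  - by rewrite eMx; apply: contra yM; apply/subsetP/cover_localize_sub.
  move=> i' ei; rewrite eMx !localizeU => h; exists i' => //.
  have -> : [set x] :|: G = G :\ x :|: [set x].
    by apply/setP => z; rewrite !inE; case: eqP => //= _; rewrite orbF.
  suff -> : V :\: G :\ x = V :\ x :\: (G :\ x) by [].
  by apply/setP => z; rewrite !inE; case: eqP.
have leM' : #|localize G (M :\ G)| < N by apply: leq_trans leM; apply: card_localize_lt.
have cV : cover (localize G (M :\ G)) \subset V :\: G.
  exact: cover_localize (subset_trans (coverS (subsetDl _ _)) MV).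
have left : nz (localize G (M :\ G)) i' #|V :\: G| -> nz M i #|V|.
  by move=> h; apply/(has_betti_top_leaf _ hM MV GM yG yM); exists i'.
case/(IH _ _ _ leM' (hyperforest_localize hM') cV) => [/left|h]; first by left.
(* If [x] lies in [G], the support is V \ G in both alternatives; otherwise [G] fits into [V :\ x]
   and is put back there. *)
have [xG|xG] := boolP (x \in G).
  have e : V :\: G :\ x = V :\: G.
    by apply/setP => z; rewrite !inE; case: eqP => // ->; rewrite xG.
  by left; apply: left; rewrite e restrict_full in h.
right; have e : G :|: (V :\: G :\ x) = V :\ x.
  apply/setP => z; rewrite !inE; have [zG|//] := boolP (z \in G).
  by rewrite (subsetP GV) // andbT; case: eqP => // zx; rewrite -zx zG in xG.
have GVx : G \subset V :\ x by rewrite -e subsetUl.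
have eR : (M :\ G) ::&: (V :\ x) = (M ::&: (V :\ x)) :\ G.
  by apply/setP => H; rewrite !inE andbA.
rewrite localize_restrict e eR in h.
apply: (iffRL (has_betti_top_leaf (F := G) (y := y) _
    (hyperforest_restrict hM) _ _ _ _)) => //.
- exact: cover_restrict.
- by rewrite !inE GM.
- by rewrite -eR; apply: contra yM; apply/subsetP/coverS/restrict_sub.
exists i' => //; suff -> : V :\ x :\: G = V :\: G :\ x by [].
by apply/setP => z; rewrite !inE andbCA.
Qed.

(** The localization is undone one vertex [x] at a time: either [x] joins the support, or the
    induction continues inside [V :\ x]. *)
Lemma has_betti_localize A E V i : hyperforest E -> cover E \subset V ->
  nz (localize A E) i #|V :\: A| ->
  exists w, [/\ w \subset V, w :\: A = V :\: A & nz (E ::&: w) i #|w|].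
Proof.
move: {2}#|A| (erefl #|A|) => N; elim: N A E V => [|N IH] A E V cA hE EV.
  have -> : A = set0 by apply/eqP; rewrite -cards_eq0 cA.
  have -> : localize set0 E = E.
    by rewrite -[RHS]imset_id; apply: eq_imset => F; rewrite setD0.
  by rewrite setD0 => h; exists V; rewrite setD0 restrict_full.
have /set0Pn[x xA] : A != set0 by rewrite -cards_eq0 cA.
pose A' := A :\ x; have cA' : #|A'| = N.
  by move: cA; rewrite (cardsD1 x) xA add1n => -[].
have eA : A = [set x] :|: A' by rewrite setD1K.
have eD u : u :\: A = u :\: A' :\ x by rewrite setDDl setUC -eA.
rewrite eD {1}eA -localizeU.
case/(has_betti_localize1 (hyperforest_localize hE) (cover_localize _ EV)).
  case/(IH _ _ _ cA' hE EV) => w [wV ew h].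
  by exists w; split=> //; rewrite !eD ew.
have eR : E ::&: (A' :|: (V :\: A' :\ x)) = E ::&: (V :\ x).
  apply/setP => F; rewrite !inE; have [FE|//] := boolP (F \in E); rewrite /=.
  have FV : F \subset V := subset_trans (bigcup_sup _ FE) EV.
  apply/subsetP/subsetP => hF z zF; have := hF z zF; rewrite !inE (subsetP FV z zF).
    by case: eqP.
  by case: eqP => //= _; case: (z \in A).
have eV : V :\: A' :\ x = V :\ x :\: A' by rewrite !setDDl setUC.
rewrite localize_restrict eR eV.
case/(IH _ _ _ cA' (hyperforest_restrict hE) (cover_restrict _ _)) => w [wV ew].
rewrite restrict_restrict // => h; exists w; split=> //.
  exact: subset_trans wV (subsetDl _ _).
by rewrite eD ew; apply/setP => z; rewrite !inE; case: eqP.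
Qed.

(** Stated for any [V] and for families that need not be antichains, because the induction passes to
    a localized family on V \ F. *)
Lemma hyperforest_complements E V a b : hyperforest E -> cover E \subset V ->
  nz E (a + b) #|V| -> 0 < a -> 0 < b ->
  exists u w, [/\ u \proper V, w \proper V, u :|: w = V,
    forall F, F \in E -> ~~ ((F \subset u) && (F \subset w)) &
    nz (E ::&: u) a #|u| /\ nz (E ::&: w) b #|w|].
Proof.
move: {2}_.+1 (ltnSn #|E|) => N; elim: N E V a => // N IH E V a leN hE EV.
rewrite -(eq_has_betti (monomial_ideal_minimals E)) => hab a0 b0.
have hM : hyperforest (minimals E) := hyperforestS (minimals_sub E) hE.
have aM := @antichain_minimals _ E.
have leM : #|minimals E| <= N.
  exact: leq_trans (subset_leq_card (minimals_sub E)) _.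
have MV : cover (minimals E) \subset V := subset_trans (coverS (minimals_sub E)) EV.
suff [u [w [uV wV uwV disj [hu hw]]]] : exists u w,
    [/\ u \proper V, w \proper V, u :|: w = V,
    forall F, F \in minimals E -> ~~ ((F \subset u) && (F \subset w)) &
    nz (minimals E ::&: u) a #|u| /\ nz (minimals E ::&: w) b #|w|].
  exists u, w; split=> //; last first.
    by rewrite -!(eq_has_betti (monomial_ideal_restrict_minimals E _)).
  move=> F /minimals_below[G GE GF]; apply: contra (disj G GE) => /andP[Fu Fw].
  by rewrite !(subset_trans GF).
move: (minimals E) hM aM leM MV hab => M hM aM leM MV hab {E leN hE EV}.
have [M0|M0] := boolP (set0 \in M); first by case: (has_betti_unit M0 hab).
have [Mn0|Mn0] := eqVneq M set0.
  move: hab; rewrite Mn0 => /has_betti0[/eqP]; rewrite addn_eq0 => /andP[/eqP e].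
  by rewrite e in a0.
have [F [y [FM yF yM]]] := exists_free_vertex aM hM Mn0 M0.
have FV : F \subset V := subset_trans (bigcup_sup _ FM) MV.
have [i' ei hi'] := (has_betti_top_leaf _ hM MV FM yF yM).1 hab.
(* From here [a] is the original value minus one, as [F] uses up one homological degree. *)
case: a a0 ei {hab} => // a _; rewrite addSn => -[ei]; rewrite -{i'}ei in hi'.
have hM' := hyperforestD1 (F := F) hM.
set M' := localize F (M :\ F) in hi'.
have hM'F : hyperforest M' := hyperforest_localize hM'.
have M'V : cover M' \subset V :\: F.
  exact: cover_localize (subset_trans (coverS (subsetDl _ _)) MV).
(* Properness of [w] is not asked for: when [a] is 0, [u] is empty and [w] is all of V \ F. *)
have [u [w [uV wV uwV disj [hu hw]]]] : exists u w,
    [/\ u \proper V :\: F, w \subset V :\: F, u :|: w = V :\: F,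
    forall G, G \in M' -> ~~ ((G \subset u) && (G \subset w)) &
    nz (M' ::&: u) a #|u| /\ nz (M' ::&: w) b #|w|].
  have [a0|a0] := posnP a; last first.
    have leM' : #|M'| < N by apply: leq_trans leM; apply: card_localize_lt.
    have [u [w [uV wV *]]] := IH _ _ _ leM' hM'F M'V hi' a0 b0.
    by exists u, w; split=> //; apply: proper_sub.
  have M'0 : set0 \notin M' by apply/negP => /has_betti_unit; apply; apply: hi'.
  have e0 : M' ::&: set0 = set0.
    apply/setP => G; rewrite !inE subset0; apply/negP => /andP[GM' /eqP eG].
    by rewrite -eG GM' in M'0.
  (* V \ F is nonempty: otherwise [M'] would be empty, with no Betti number in the positive degree
     [b]. *)
  exists set0, (V :\: F); rewrite set0U e0 restrict_full // a0; split=> //.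
  - rewrite proper0; apply/eqP => VF0; move: hi'; rewrite VF0 a0 add0n.
    rewrite -(restrict_full M'V) VF0 e0 => /has_betti0[b00].
    by rewrite b00 in b0.
  - move=> G GM'; rewrite subset0; apply: contra M'0 => /andP[/eqP <- //].
  - by split; [apply/has_betti0; rewrite cards0 | rewrite a0 in hi'].
have Fw : [disjoint F & w].
  rewrite disjoint_sym; apply: disjointWl wV _.
  by rewrite -setI_eq0 setDE -setIA [~: F :&: F]setIC setICr setI0.
(* Since [y] is free in [F], delocalization can take place inside (F ∪ w) \ y. The resulting [w']
   misses [y], so it is proper and does not contain [F]. *)
have cw : cover ((M :\ F) ::&: (F :|: w)) \subset (F :|: w) :\ y.
  rewrite subsetD1 cover_restrict; apply: contra yM.
  exact/subsetP/coverS/restrict_sub.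
have ew : (F :|: w) :\ y :\: F = w.
  apply/setP => z; rewrite !inE; have [zF|zF] := boolP (z \in F) => /=.
    by rewrite (disjointFr Fw).
  by case: eqP => // zy; rewrite zy yF in zF.
rewrite localize_restrict -{2}ew in hw.
have [w' [w'V ew' hw']] := has_betti_localize (hyperforest_restrict hM') cw hw.
move: w'V; rewrite subsetD1 => /andP[w'Fw yw'].
have nFw' : ~~ (F \subset w') by apply: contra yw' => /subsetP; apply.
have w'V : w' \subset V.
  apply: subset_trans w'Fw _; rewrite subUset FV.
  exact: subset_trans wV (subsetDl _ _).
rewrite ew in ew'.
(* As w' \ F = w, the two sets cover [V], and a member G ≠ F inside both would put G \ F inside both
   [u] and [w]. *)
exists (F :|: u), w'; split.
- rewrite properE subUset FV (subset_trans (proper_sub uV) (subsetDl _ _)) /=.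
  apply: contra (proper_subn uV) => Vu; rewrite subDset //.
- rewrite properE w'V; apply: contra yw' => /subsetP; apply.
  exact: (subsetP FV).
- apply/eqP; rewrite eqEsubset !subUset FV w'V /=.
  rewrite (subset_trans (proper_sub uV) (subsetDl _ _)) /= -setUA.
  rewrite -subDset -uwV setUS // -ew'; exact: subsetDl.
- move=> G GM; have [->|GF] := eqVneq G F; first by rewrite negb_and nFw' orbT.
  have GM' : G :\: F \in M' by apply: imset_f; rewrite !inE GF.
  apply: contra (disj _ GM') => /andP[Gu Gw].
  by rewrite subDset Gu -ew' setSD.
split.
  apply: (iffRL (has_betti_top_leaf (F := F) (y := y) _
    (hyperforest_restrict hM) _ _ _ _)) => //.
  - exact: cover_restrict.
  - by rewrite !inE FM subsetUl.
  - by apply: contra yM; apply/subsetP/coverS/setSD/restrict_sub.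
  exists a => //.
  have -> : (M ::&: (F :|: u)) :\ F = (M :\ F) ::&: (F :|: u).
    by apply/setP => G; rewrite !inE andbA.
  rewrite -localize_restrict -/M'.
  suff -> : (F :|: u) :\: F = u by [].
  rewrite setDUl setDv set0U; apply/setDidPl; rewrite disjoint_sym.
  rewrite -setI_eq0 -subset0 -(setICr F) setIS //.
  by apply: subset_trans (proper_sub uV) _; rewrite setDE subsetIr.
rewrite restrict_restrict // in hw'.
suff -> : M ::&: w' = (M :\ F) ::&: w' by [].
apply/setP => G; rewrite !inE; case: (eqVneq G F) => [->|//].
by rewrite (negPf nFw') andbF.
Qed.

End BettiForests.

(** * From facets of simplicial forests to hyperforests *)

Section FacetComplexes.

Variable n : nat.
Implicit Types (D E : {set {set 'I_n}}).

Definition generated_complex E : {set {set 'I_n}} :=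
  [set f : {set 'I_n} | [exists F in E, f \subset F]].

Lemma antichain_facets D : antichain (facets D).
Proof.
move=> F G; rewrite !inE => /andP[_ /forall_inP hF] /andP[GD _] FG.
by have /implyP/(_ FG)/eqP := hF G GD.
Qed.

Lemma facets_generated E : antichain E -> facets (generated_complex E) = E.
Proof.
move=> aE; have sE F : F \in E -> F \in generated_complex E.
  by move=> FE; rewrite inE; apply/existsP; exists F; rewrite FE subxx.
apply/setP => F; rewrite inE; apply/andP/idP => [[]|FE].
  rewrite inE => /exists_inP[G GE FG] /forall_inP/(_ G (sE G GE)).
  by rewrite FG => /eqP <-.
split; first exact: sE.
apply/forall_inP => G; rewrite inE => /exists_inP[H HE GH]; apply/implyP => FG.
by rewrite eqEsubset FG andbT (aE _ _ FE HE (subset_trans FG GH)).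
Qed.

Lemma facets_induced D u : facets (induced D u) = facets D ::&: u.
Proof.
rewrite -[RHS]facets_generated; last first.
  move=> F G /(subsetP (restrict_sub _ _)) FD /(subsetP (restrict_sub _ _)).
  exact: antichain_facets.
congr facets; apply/setP => f; rewrite !inE; apply: eq_existsb => F.
by rewrite !inE andbA.
Qed.

(** Any subfamily of facets is the facet set of the subcollection it generates, so the leaf
    condition transfers. *)
Lemma hyperforest_facets D : simplicial_forest D -> hyperforest (facets D).
Proof.
case=> _ hD E' E'D E'0.
have fE' : facets (generated_complex E') = E'.
  by apply: facets_generated => F G /(subsetP E'D) FD /(subsetP E'D); apply: antichain_facets.
have [|| F [FE' hF]] := hD (generated_complex E').
- split; last by rewrite fE'.
  move=> F G; rewrite !inE => /exists_inP[H HE FH] GF; apply/exists_inP.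
  by exists H => //; apply: subset_trans FH.
- have /set0Pn[F FE'] := E'0; apply/set0Pn; exists F.
  by rewrite inE; apply/existsP; exists F; rewrite FE' subxx.
by rewrite fE' in FE' hF; exists F.
Qed.

End FacetComplexes.

Theorem theorem3p5 (k : fieldType) (n : nat) (D : {set {set 'I_n}})
    (i a b : nat)
    (hforest : simplicial_forest D)
    (hfacets : 1 < #|facets D|)
    (hbetti : betti k D i n <> 0)
    (hi : i = a + b) (ha : 0 < a) (hb : 0 < b) :
  exists u w : {set 'I_n},
    [/\ complements D u w,
        betti k (induced D u) a #|u| <> 0
      & betti k (induced D w) b #|w| <> 0].
Proof.
have hD := hyperforest_facets hforest.
have DT : cover (facets D) \subset [set: 'I_n] := subsetT _.
move: hbetti; rewrite hi => /(betti_neq0 _ _ (resolvable_hyperforest k hD)) hab.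
(* The degree [n] becomes the size of the full vertex set, which plays the role of [V]. *)
rewrite -[X in has_betti _ _ _ X]card_ord -cardsT in hab.
have [u [w [uT wT uw disj [hu hw]]]] := hyperforest_complements hD DT hab ha hb.
have nz v j : has_betti k (facets D ::&: v) j #|v| -> betti k (induced D v) j #|v| <> 0.
  rewrite -facets_induced => h; apply/betti_neq0 => //.
  by apply: resolvable_hyperforest; rewrite facets_induced; apply: hyperforest_restrict.
exists u, w; split; [|exact: nz..]; split=> //.
  (* Nonvanishing in degree [n] forces the facets to cover all vertices. *)
  exact: has_betti_top_cover hab.
apply/pred0P => F; rewrite /= !facets_induced !inE; apply/negP.
case/andP=> /andP[FD Fu] /andP[_ Fw].
by have := disj F; rewrite inE FD Fu Fw => /(_ isT).
Qed.
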